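(* Let $(b_n)_{n\ge 2}$ be any sequence with $b_n\in\mathbb{Q}$ for all $n\ge 2$. Then there exists a compatible family $F=(F_n)_{n\ge 1}$ such that $\deg F_n\le 2$ (total degree) for all $n\ge 1$ and $$F_{n-1}(\alpha_{1,n},\dots,\alpha_{n-1,n})=b_n\qquad\text{for all } n\ge 2.$$ In particular, value-level $G_n$-invariance does not imply summability at cosine points, even among compatible families of uniformly bounded total degree; that is, there exists a compatible family of uniformly bounded total degree which is value-level $G_n$-invariant at every level $n\ge 2$ but is not summable at cosine points.
   Context: For $n\ge 2$ let $\omega_n=e^{2\pi i/n}$, $G_n=\mathrm{Gal}(\mathbb{Q}(\omega_n)/\mathbb{Q})$, and $\alpha_{k,n}=\cos(2\pi k/n)\in\mathbb{Q}(\omega_n)$ for $1\le k\le n-1$. A compatible family is a sequence $F=(F_n)_{n\ge 1}$ with $F_n\in\mathbb{Q}[x_1,\dots,x_n]$ and $F_n(x_1,\dots,x_n)=F_{n+1}(x_1,\dots,x_n,0)$ for all $n\ge 1$. For $n\ge 2$ its cosine-point evaluation is $a_F(n)=F_{n-1}(\alpha_{1,n},\dots,\alpha_{n-1,n})$. $F$ is value-level $G_n$-invariant at level $n$ if $a_F(n)$ is fixed by $G_n$, equivalently $a_F(n)\in\mathbb{Q}$. $F$ is summable at cosine points if there exist an integer $N\ge 2$ and a rational function $R(n)\in\mathbb{Q}(n)$, defined at every integer $n\ge N$, such that $a_F(n)=R(n)$ for all integers $n\ge N$. *)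

(* Defs.v *)
(* Mathematical Components, with cos, sin and pi from MathComp-Analysis. *)
From HB Require Import structures.
From mathcomp Require Import all_boot all_order all_algebra all_field.
From mathcomp Require Import fraction mpoly complex reals.
(* [trigo] is not imported: its notations clash with those of [mpoly]. *)
From mathcomp Require trigo.

Set Implicit Arguments.
Unset Strict Implicit.
Unset Printing Implicit Defensive.

Import GRing.Theory Num.Theory.

Local Open Scope ring_scope.
Local Open Scope complex_scope.

(* e^(2 pi i / n), through Euler's formula *)
Definition omega (R : realType) (n : nat) : R[i] :=
  trigo.cos (2 * trigo.pi / n%:R) +i* trigo.sin (2 * trigo.pi / n%:R).

Definition alpha (R : realType) (k n : nat) : R :=
  trigo.cos (2 * trigo.pi * k%:R / n%:R).

(* Families are indexed by n >= 1; the entry F 0 is never used. *)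
Definition poly_family := forall n : nat, {mpoly rat[n]}.

Definition compatible (F : poly_family) : Prop :=
  forall n : nat, (1 <= n)%N ->
    F n = F n.+1 \mPo [tuple of rcons [tuple 'X_i | i < n] 0].

(* msize p is the total degree of p plus one (and 0 for p = 0). *)
Definition total_degree_le (F : poly_family) (d : nat) : Prop :=
  forall n : nat, (1 <= n)%N -> (msize (F n) <= d.+1)%N.

(* The variable of index k : 'I_n.-1 is the paper's x_(k+1). *)
Definition cosine_eval (R : realType) (F : poly_family) (n : nat) : R :=
  mmap (@ratr R) (fun k : 'I_n.-1 => alpha R k.+1 n) (F n.-1).

(* The field Q(omega_n) is presented as an extension L of rat, generated by
   some w, with an embedding into R[i] that sends w to omega_n.  Such a
   presentation is unique up to a unique isomorphism, so its choice does not
   matter; the existential also makes a be an element of Q(omega_n). *)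
Definition fixed_by_cyclotomic_galois (R : realType) (n : nat) (a : R[i]) :
    Prop :=
  exists (L : splittingFieldType rat) (iota : {rmorphism L -> R[i]}) (w x : L),
    [/\ <<1; w>>%VS = fullv, iota w = omega R n, iota x = a
      & x \in fixedField ('Gal({:L} / 1))%g].

Definition value_level_invariant (R : realType) (F : poly_family) (n : nat) : Prop :=
  fixed_by_cyclotomic_galois n (cosine_eval R F n)%:C.

(* The rational function f is defined at c, where it takes the value v. *)
Definition ratfun_value (f : {fraction {poly rat}}) (c v : rat) : Prop :=
  exists p q : {poly rat},
    [/\ f = tofrac p / tofrac q, q.[c] != 0 & v = p.[c] / q.[c]].

Definition summable_at_cosine_points (R : realType) (F : poly_family) : Prop :=
  exists (N : nat) (f : {fraction {poly rat}}), (2 <= N)%N /\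
    forall n : nat, (N <= n)%N ->
      exists2 v : rat, ratfun_value f n%:R v & cosine_eval R F n = ratr v.

(* Main.v *)
(* A compatible family of degree at most 2 amounts to a constant together with,
   for each m, an increment x_m (l + sum_(i <= m) q_i x_i), which first enters
   at level n = m + 1.  At that level x_m takes the value
   alpha_(n-1,n) = alpha_(1,n), while 1 and the alpha_(i,n) span the ring
   Q[alpha_(1,n)] over Q, by the product formula for cosines.  This ring is a
   field because alpha_(1,n) is algebraic (a root of T_n - 1, for T_n the
   Chebyshev polynomial), so if alpha_(1,n) <> 0 the increment can be given any
   prescribed value in Q[alpha_(1,n)], and the b_n are reached one level after
   the other.  Only alpha_(1,4) vanishes: the increments of x_1 and x_3 are
   taken to be zero, and that of x_2 handles the levels 3 and 4 together.
   For the second part take b_n to be the parity of n: a rational function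
   with these values has infinitely many zeros, hence is zero. *)
From HB Require Import structures.
Require Import Defs.
From mathcomp Require Import all_boot all_order all_algebra all_field.
From mathcomp Require Import fraction mpoly complex reals ring lra.
From mathcomp Require boolp trigo.

Set Implicit Arguments.
Unset Strict Implicit.
Unset Printing Implicit Defensive.

Import Order.TTheory GRing.Theory Num.Theory.

Local Open Scope ring_scope.
Local Open Scope complex_scope.

(** * Adjoining one variable while keeping the degree at most two *)

Section Extension.
Variable K : idomainType.

(** The components [c.1] and [c.2] are the l and the q_i of the increment; the sum also contains the
    new variable itself. *)
Definition extend n (p : {mpoly K[n]}) (c : K * ('I_n.+1 -> K)) :
    {mpoly K[n.+1]} :=
  mwiden p + 'X_ord_max * (c.1%:MP + \sum_i c.2 i *: 'X_i).

Lemma msize_mwiden n (p : {mpoly K[n]}) : (msize (mwiden p) <= msize p)%N.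
Proof.
rewrite (mwidenE (leqnn _)); apply: (leq_trans (msize_sum _ _ _)).
apply/bigmax_leqP => m _; apply: (leq_trans (msizeZ_le _ _)).
rewrite msizeX (leq_trans _ (bmdeg m)) // ltnS !mdegE big_ord_recr /=.
rewrite mnmwiden_ordmax addn0 leq_eqVlt; apply/orP; left; apply/eqP.
by apply: eq_bigr => i _; rewrite mnmwiden_widen.
Qed.

Lemma msize_extend n (p : {mpoly K[n]}) c :
  (msize p <= 3)%N -> (msize (extend p c) <= 3)%N.
Proof.
move=> p3; apply: (leq_trans (msizeD_le _ _)).
rewrite geq_max (leq_trans (msize_mwiden p)) //=.
set q := _ + _; have q2 : (msize q <= 2)%N.
  apply: (leq_trans (msizeD_le _ _)).
  rewrite geq_max msizeC; apply/andP; split; first by case: (_ == _).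
  apply: (leq_trans (msize_sum _ _ _)); apply/bigmax_leqP => i _.
  by rewrite (leq_trans (msizeZ_le _ _)) // msizeX mdeg1.
have [->|q0] := eqVneq q 0; first by rewrite mulr0 msize0.
have X0 : 'X_ord_max != 0 :> {mpoly K[n.+1]}.
  by rewrite -msize_poly_eq0 msizeX.
by rewrite msizeM // msizeX mdeg1.
Qed.

Lemma mmap_mwiden (S : comNzRingType) (f : {rmorphism K -> S}) n
    (h : 'I_n.+1 -> S) (p : {mpoly K[n]}) :
  mmap f h (mwiden p) = mmap f (h \o widen_ord (leqnSn n)) p.
Proof.
rewrite [in LHS](mpolyE p) (raddf_sum (@mwiden n K)) (raddf_sum (mmap f h)) /=.
rewrite [RHS]/mmap; apply: eq_bigr => m _.
rewrite mwidenZ mmapZ mwidenX mmapX; congr (_ * _).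
rewrite /mmap1 big_ord_recr /= mnmwiden_ordmax expr0 mulr1.
by apply: eq_bigr => i _; rewrite mnmwiden_widen.
Qed.

Lemma mmap_extend (S : comNzRingType) (f : {rmorphism K -> S}) n
    (h : 'I_n.+1 -> S) (p : {mpoly K[n]}) c :
  mmap f h (extend p c)
  = mmap f (h \o widen_ord (leqnSn n)) p
    + h ord_max * (f c.1 + \sum_i f (c.2 i) * h i).
Proof.
rewrite /extend mmapD (rmorphM (mmap f h)) /= mmap_mwiden mmapD mmapX mmap1U.
rewrite mmapC (raddf_sum (mmap f h)); congr (_ + _ * (_ + _)).
by apply: eq_bigr => i _ /=; rewrite mmapZ mmapX mmap1U.
Qed.

(** The increment is a multiple of the last variable, so it disappears when that variable is set to
    0. *)
Lemma extend_compatible n (p : {mpoly K[n]}) c :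
  p = extend p c \mPo [tuple of rcons [tuple 'X_i | i < n] 0].
Proof.
rewrite /comp_mpoly mmap_extend (tnth_nth 0) /= nth_rcons size_map.
rewrite size_enum_ord ltnn eqxx mul0r addr0 -[LHS]comp_mpoly_id /comp_mpoly.
rewrite /mmap; apply: eq_bigr => m _; congr (_ * _).
apply: mmap1_eq => i /=; rewrite !(tnth_nth 0) /= nth_rcons.
by rewrite size_map size_enum_ord ltn_ord.
Qed.

End Extension.

(** * The ring generated over a field by one element *)

Section PolyValue.
Variables (F : fieldType) (K : fieldType) (f : {rmorphism F -> K}) (y : K).

Definition poly_value (x : K) := exists p : {poly F}, x = (map_poly f p).[y].

Lemma poly_value_scalar a : poly_value (f a).
Proof. by exists a%:P; rewrite map_polyC hornerC. Qed.

Lemma poly_valueD x z : poly_value x -> poly_value z -> poly_value (x + z).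
Proof. by move=> [p ->] [q ->]; exists (p + q); rewrite rmorphD hornerD. Qed.

Lemma poly_valueM x z : poly_value x -> poly_value z -> poly_value (x * z).
Proof. by move=> [p ->] [q ->]; exists (p * q); rewrite rmorphM hornerM. Qed.

Lemma poly_value_mmap n (h : 'I_n -> K) (p : {mpoly F[n]}) :
  (forall i, poly_value (h i)) -> poly_value (mmap f h p).
Proof.
move=> hP.
have p0 : poly_value 0 by rewrite -(rmorph0 f); apply: poly_value_scalar.
have p1 : poly_value 1 by rewrite -(rmorph1 f); apply: poly_value_scalar.
rewrite /mmap; elim/big_ind: _ => [//||m _]; first exact: poly_valueD.
apply: poly_valueM; first exact: poly_value_scalar.
rewrite /mmap1; elim/big_ind: _ => [//||i _]; first exact: poly_valueM.
by elim: (m i) => [|k IH]; rewrite ?expr0 ?exprS //; apply: poly_valueM.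
Qed.

(** Write the annihilating polynomial as p X + c. If c <> 0, then p(y) y = -c gives y^-1 = -p(y) /
    c; if c = 0, then y cancels and p itself annihilates y. *)
Lemma poly_valueV (p : {poly F}) :
  y != 0 -> p != 0 -> root (map_poly f p) y -> poly_value y^-1.
Proof.
move=> y0; elim/poly_ind: p => [|p c IH]; first by rewrite eqxx.
rewrite /root rmorphD rmorphM /= map_polyX map_polyC hornerMXaddC.
have [->|c0] := eqVneq c 0.
  rewrite raddf0 polyC0 !addr0 !mulf_eq0 polyX_eq0 (negPf y0) !orbF.
  exact: IH.
move=> _ /eqP E; exists ((- c^-1) *: p).
rewrite map_polyZ hornerZ rmorphN fmorphV.
have fc0 : f c != 0 by rewrite fmorph_eq0.
apply: (mulIf y0); rewrite mulVf // -mulrA.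
have -> : (map_poly f p).[y] * y = - f c by apply/eqP; rewrite -addr_eq0 E.
by rewrite mulrNN mulVf.
Qed.
End PolyValue.

(** * Chebyshev polynomials of the first kind *)

Fixpoint cheb (k : nat) : {poly rat} :=
  if k is k1.+1 then
    if k1 is k2.+1 then 'X *+ 2 * cheb k1 - cheb k2 else 'X
  else 1.

Lemma chebSS k : cheb k.+2 = 'X *+ 2 * cheb k.+1 - cheb k.
Proof. by []. Qed.

(** At 2 the recurrence reads T_(k+2) = 4 T_(k+1) - T_k, so the values increase strictly from T_0(2)
    = 1. Hence T_k - 1 is a nonzero polynomial for k > 0. *)
Lemma cheb2_mono k : 1 <= (cheb k).[2] < (cheb k.+1).[2].
Proof.
elim: k => [|k]; first by rewrite /= !hornerE.
rewrite chebSS hornerD hornerN hornerM hornerMn hornerX.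
by move=> /andP[h1 h2]; apply/andP; split; lra.
Qed.

Lemma cheb_neq1 k : (0 < k)%N -> cheb k - 1 != 0.
Proof.
case: k => // k _; apply/eqP => /(congr1 (horner^~ 2)); rewrite !hornerE.
by have /andP[h1 h2] := cheb2_mono k; lra.
Qed.

(** * The numbers alpha_(k,n) and their rational span *)

Section Cosines.
Variable R : realType.
Implicit Types (n : nat) (t x : R).

Lemma cos_prosthaphaeresis t x :
  trigo.cos x * trigo.cos t = (trigo.cos (t + x) + trigo.cos (t - x)) / 2.
Proof. by rewrite trigo.cosD trigo.cosB; field. Qed.

Lemma cheb_cos t k :
  (map_poly (@ratr R) (cheb k)).[trigo.cos t] = trigo.cos (t *+ k).
Proof.
(* The recurrence has order two, so the induction carries two consecutive indices. *)
suff [] : (map_poly (@ratr R) (cheb k)).[trigo.cos t] = trigo.cos (t *+ k) /\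
  (map_poly (@ratr R) (cheb k.+1)).[trigo.cos t] = trigo.cos (t *+ k.+1) by [].
elim: k => [|k [IH1 IH2]].
  by rewrite /= rmorph1 hornerC map_polyX hornerX trigo.cos0.
split=> //; rewrite chebSS rmorphB rmorphM /= rmorphMn /= map_polyX.
rewrite hornerD hornerN hornerM hornerMn hornerX.
rewrite -/(cheb k.+1) IH1 IH2 mulrnAl cos_prosthaphaeresis.
have -> : t *+ k.+1 - t = t *+ k by rewrite mulrSr; ring.
by rewrite -mulrSr; field.
Qed.

Lemma alphaE k n : alpha R k n = trigo.cos (2 * trigo.pi / n%:R *+ k).
Proof. by rewrite /alpha -mulr_natr; congr trigo.cos; ring. Qed.

Lemma alpha0n n : alpha R 0 n = 1.
Proof. by rewrite alphaE trigo.cos0. Qed.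

Lemma alphann n : (0 < n)%N -> alpha R n n = 1.
Proof.
move=> n0; rewrite /alpha mulfK ?pnatr_eq0 -?lt0n //.
by rewrite mulr_natl trigo.cos2pi.
Qed.

Lemma alphaB k n : (0 < n)%N -> (k <= n)%N -> alpha R (n - k) n = alpha R k n.
Proof.
move=> n0 kn; rewrite /alpha -[RHS]trigo.cosN -[RHS]trigo.cosD2pi.
congr trigo.cos; rewrite natrB //; by field; rewrite pnatr_eq0 -lt0n.
Qed.

(** For n > 4 the angle 2 pi / n lies strictly between 0 and pi / 2. *)
Lemma alpha1_neq0 n : (4 < n)%N -> alpha R 1 n != 0.
Proof.
move=> n4; have n0 : 0 < n%:R :> R by rewrite ltr0n; case: (n) n4.
have pi0 := trigo.pi_gt0 R.
apply/lt0r_neq0/trigo.cos_gt0_pihalf; rewrite mulr1.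
apply/andP; split.
  apply: (@lt_trans _ _ 0); first by lra.
  by rewrite divr_gt0 ?mulr_gt0.
rewrite ltr_pdivrMr //.
have : 4 < n%:R :> R by rewrite ltr_nat.
by nra.
Qed.

Lemma alphaM1 k n : alpha R 1 n * alpha R k.+1 n
  = (alpha R k.+2 n + alpha R k n) / 2.
Proof.
rewrite !alphaE cos_prosthaphaeresis; congr ((trigo.cos _ + trigo.cos _) / 2).
  by rewrite -mulrnDr addn1.
by rewrite mulrSr; ring.
Qed.

Lemma cheb_alpha k n :
  (map_poly (@ratr R) (cheb k)).[alpha R 1 n] = alpha R k n.
Proof. by rewrite alphaE cheb_cos mulr1n -alphaE. Qed.

Lemma poly_value_alpha k n : poly_value (@ratr R) (alpha R 1 n) (alpha R k n).
Proof. by exists (cheb k); rewrite cheb_alpha. Qed.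

Lemma alpha1_algebraic n : (0 < n)%N ->
  root (map_poly (@ratr R) (cheb n - 1)) (alpha R 1 n).
Proof.
move=> n0; rewrite /root rmorphB /= rmorph1 hornerD hornerN hornerC.
by rewrite cheb_alpha alphann // subrr.
Qed.

(** Index 0 supplies the constants, since alpha_(0,n) = 1. *)
Definition cos_span n x :=
  exists c : 'I_n -> rat, x = \sum_k ratr (c k) * alpha R k n.

Lemma cos_spanD n x t : cos_span n x -> cos_span n t -> cos_span n (x + t).
Proof.
move=> [c ->] [d ->]; exists (fun k => c k + d k); rewrite -big_split /=.
by apply: eq_bigr => k _; rewrite rmorphD mulrDl.
Qed.

Lemma cos_spanZ n a x : cos_span n x -> cos_span n (ratr a * x).
Proof.
move=> [c ->]; exists (fun k => a * c k); rewrite mulr_sumr.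
by apply: eq_bigr => k _; rewrite rmorphM mulrA.
Qed.

(** The case k = n is included because the product formula at the last index n - 1 produces
    alpha_(n,n), which equals alpha_(0,n). *)
Lemma cos_span_alpha n k : (0 < n)%N -> (k <= n)%N -> cos_span n (alpha R k n).
Proof.
move=> n0; rewrite leq_eqVlt => /predU1P[->|kn].
  rewrite alphann // -(alpha0n n); exists (fun j => (val j == 0%N)%:R).
  rewrite (bigD1 (Ordinal n0)) //= rmorph1 mul1r big1 ?addr0 // => j jn0.
  by rewrite -[val j == 0%N]/(j == Ordinal n0) (negPf jn0) rmorph0 mul0r.
exists (fun j => (j == Ordinal kn)%:R).
rewrite (bigD1 (Ordinal kn)) //= eqxx rmorph1 mul1r big1 ?addr0 // => j jn0.
by rewrite (negPf jn0) rmorph0 mul0r.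
Qed.

Lemma cos_span_mul_alpha1 n x :
  (1 < n)%N -> cos_span n x -> cos_span n (alpha R 1 n * x).
Proof.
move=> n1 [c ->]; have n0 := ltnW n1.
have s0 : cos_span n 0.
  rewrite -(mul0r 1) -(rmorph0 (@ratr R)) -(alphann n0).
  exact/cos_spanZ/cos_span_alpha.
rewrite mulr_sumr; elim/big_ind: _ => // [|k _]; first exact: cos_spanD.
rewrite mulrCA; apply: cos_spanZ; case: k => -[|k] /= kn.
  by rewrite alpha0n mulr1; apply: cos_span_alpha.
rewrite alphaM1 mulrC -[2]/(2%:R) -(ratr_nat R) -fmorphV.
by apply/cos_spanZ/cos_spanD; apply: cos_span_alpha => //; do 2!apply: ltnW.
Qed.

Lemma poly_value_cos_span n x :
  (1 < n)%N -> poly_value (@ratr R) (alpha R 1 n) x -> cos_span n x.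
Proof.
move=> n1 [p ->{x}]; elim/poly_ind: p => [|p c IH].
  rewrite rmorph0 horner0 -(mul0r 1) -(rmorph0 (@ratr R)) -(alpha0n n).
  by apply/cos_spanZ/cos_span_alpha => //; apply: ltnW.
rewrite rmorphD rmorphM /= map_polyX map_polyC hornerMXaddC.
rewrite mulrC -[X in _ + X]mulr1 -(alpha0n n).
apply: cos_spanD; first exact: cos_span_mul_alpha1.
by apply/cos_spanZ/cos_span_alpha => //; apply: ltnW.
Qed.

Lemma cos_span_div_alpha1 n x : (4 < n)%N ->
  poly_value (@ratr R) (alpha R 1 n) x -> cos_span n ((alpha R 1 n)^-1 * x).
Proof.
move=> n4 xv; have n1 : (1 < n)%N by apply: leq_trans n4.
apply/(poly_value_cos_span n1)/poly_valueM => //.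
apply: (@poly_valueV _ _ _ _ (cheb n - 1)); first exact: alpha1_neq0.
  by rewrite cheb_neq1 // ltnW.
by rewrite alpha1_algebraic // ltnW.
Qed.

End Cosines.

(** * Construction of the family, one level after the other *)

(** The function [c] receives the polynomial built so far, because the increment required at a level
    depends on the value already reached there. *)
Fixpoint extend_family (K : idomainType) (a : K)
    (c : forall n, {mpoly K[n]} -> K * ('I_n.+1 -> K)) n : {mpoly K[n]} :=
  if n is m.+1 then
    let p := extend_family a c m in extend p (c m p)
  else a%:MP.

Lemma msize_extend_family (K : idomainType) (a : K) c n :
  (msize (extend_family a c n) <= 3)%N.
Proof.
elim: n => [|n IH]; last exact: msize_extend.
by rewrite /= msizeC; case: (_ == _).
Qed.

Section Interpolation.
Variable R : realType.

(** Here [p] has n variables and its extension n + 1, so the evaluation takes place at level n +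
    2. *)
Definition hits n (v : rat) (p : {mpoly rat[n]}) (c : rat * ('I_n.+1 -> rat)) :=
  mmap (@ratr R) (fun k : 'I_n.+1 => alpha R k.+1 n.+2) (extend p c) = ratr v.

Lemma alpha_last n : alpha R n.+1 n.+2 = alpha R 1 n.+2.
Proof. by rewrite -(@alphaB R 1 n.+2) ?subn1. Qed.

Lemma hits_exists n v (p : {mpoly rat[n]}) : (2 < n)%N ->
  exists c, hits v p c.
Proof.
(* [x] is the gap between the prescribed value and the value of [p], to be filled by the
   increment. *)
move=> n2; set x := ratr v - mmap (@ratr R)
  ((fun k : 'I_n.+1 => alpha R k.+1 n.+2) \o widen_ord (leqnSn n)) p.
have [d Ed] : cos_span n.+2 ((alpha R 1 n.+2)^-1 * x).
  apply: cos_span_div_alpha1 => //; apply: poly_valueD.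
    exact: poly_value_scalar.
  rewrite -mulN1r -(rmorphN1 (@ratr R)).
  apply: poly_valueM; first exact: poly_value_scalar.
  by apply: poly_value_mmap => i; apply: poly_value_alpha.
(* The coefficient of alpha_0 = 1 becomes l; that of alpha_(k+1) goes to the variable of index
   [k]. *)
exists (d ord0, fun k => d (lift ord0 k)).
rewrite /hits mmap_extend /= alpha_last.
have a0 : alpha R 1 n.+2 != 0 by apply: alpha1_neq0.
move: Ed; rewrite big_ord_recl /= alpha0n mulr1 => <-.
by rewrite mulVKf // /x addrCA subrr addr0.
Qed.

(** With alpha_2 = alpha_1 = a, the product formula gives 2 a^2 = a + 1, whose roots are 1 and -1/2;
    the sign of a selects the latter. *)
Lemma alpha13 : alpha R 1 3 = - 2^-1.
Proof.
have pi0 := trigo.pi_gt0 R; have aM := @alphaM1 R 0 3.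
have a23 : alpha R 2 3 = alpha R 1 3 by rewrite -(@alphaB R 1 3).
have neg : alpha R 1 3 < 0.
  have -> : alpha R 1 3 = trigo.cos (trigo.pi / 6 + trigo.pi / 2).
    by congr trigo.cos; field.
  rewrite trigo.cosDpihalf oppr_lt0 trigo.sin_gt0_pihalf //.
  by apply/andP; split; lra.
by move: aM; rewrite a23 alpha0n; nra.
Qed.

Lemma alpha23 : alpha R 2 3 = - 2^-1.
Proof. by rewrite -alpha13 -(@alphaB R 1 3). Qed.

Lemma alpha14 : alpha R 1 4 = 0.
Proof. by rewrite -trigo.cos_pihalf; congr trigo.cos; field. Qed.

Lemma alpha24 : alpha R 2 4 = -1.
Proof. by rewrite -trigo.cospi; congr trigo.cos; field. Qed.

Lemma interpolation (b : nat -> rat) :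
  exists F : poly_family,
    [/\ compatible F,
        total_degree_le F 2
      & forall n : nat, (2 <= n)%N -> cosine_eval R F n = ratr (b n)].
Proof.
have [step stepP] :
    exists step : forall n, {mpoly rat[n]} -> rat * ('I_n.+1 -> rat),
      forall n p, (2 < n)%N -> hits (b n.+2) p (step n p).
  (* The null increment is a placeholder for n <= 2. *)
  have ex n (p : {mpoly rat[n]}) : exists c, (2 < n)%N -> hits (b n.+2) p c.
    have [n2|n2] := ltnP 2 n; last by exists (0, fun=> 0).
    by have [c Pc] := hits_exists (b n.+2) p n2; exists c.
  exists (fun n p => sval (boolp.cid (ex n p))) => n p.
  by case: boolp.cid.
(* [coef n] gives the increment of x_(n+1). With increment x_2 (l + q x_1), level 4, at (0, -1, 0),
   requires b_2 - l = b_4, and level 3, at (-1/2, -1/2), requires b_2 - l/2 + q/4 = b_3. *)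
pose l := b 2 - b 4.
pose coef n : {mpoly rat[n]} -> rat * ('I_n.+1 -> rat) :=
  match n with
  | 0 => fun=> (0, fun=> 0)
  | 1 => fun=> (l, fun i => if i == ord0 then 2 * (l - 2 * (b 2 - b 3)) else 0)
  | 2 => fun=> (0, fun=> 0)
  | _ => step _
  end.
exists (extend_family (b 2) coef); split.
- by move=> n _; apply: extend_compatible.
- by move=> n _; apply: msize_extend_family.
case=> [|[|n]] // _; rewrite /cosine_eval [n.+2.-1]/=.
have [n2|] := ltnP 2 n.
  move: n2 (stepP n (extend_family (b 2) coef n)).
  by case: n => [|[|[|n]]] // n2; apply.
have mE m (h : 'I_m.+1 -> R) p c : mmap (@ratr R) h (extend p c)
    = mmap (@ratr R) (h \o widen_ord (leqnSn m)) p
      + h ord_max * (ratr c.1 + \sum_i ratr (c.2 i) * h i).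
  exact: mmap_extend.
have mC m (h : 'I_m -> R) a : mmap (@ratr R) h a%:MP = ratr a by exact: mmapC.
have r0 : ratr 0 = 0 :> R by rewrite rmorph0.
case: n => [|[|[|n]]] // _.
- by rewrite mE mC big_ord1 /= !r0 mul0r addr0 mulr0 addr0.
- rewrite !mE mC !big_ord_recl !big_ord0 /= !r0 !(mul0r, addr0, mulr0).
  rewrite [alpha R _ 3]alpha23 alpha13 /= !(rmorphM, rmorphB, rmorph_nat) /=.
  by field.
- rewrite !mE mC !big_ord_recl !big_ord0 /= !r0 !(mul0r, addr0, mulr0).
  rewrite alpha14 alpha24 mulr0 addr0 rmorphB /= mulN1r opprB.
  by rewrite addrCA subrr addr0.
Qed.

End Interpolation.

(** * The cyclotomic field and its Galois-fixed rationals *)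

Section CyclotomicField.
Variable R : realType.

Lemma de_moivre (t : R) k : (trigo.cos t +i* trigo.sin t) ^+ k
  = trigo.cos (t *+ k) +i* trigo.sin (t *+ k).
Proof.
elim: k => [|k IH]; first by rewrite expr0 !mulr0n trigo.cos0 trigo.sin0.
rewrite exprS IH !mulrS trigo.cosD trigo.sinD.
by apply/eqP; rewrite eq_complex /= eqxx addrC eqxx.
Qed.

Lemma omega_unity n : (0 < n)%N -> omega R n ^+ n = 1.
Proof.
move=> n0; have tn : (2 * trigo.pi / n%:R : R) *+ n = trigo.pi *+ 2.
  by rewrite -[LHS]mulr_natr divfK ?mulr_natl // pnatr_eq0 -lt0n.
by rewrite de_moivre tn trigo.cos2pi trigo.sin2pi.
Qed.

(** A nonzero rational polynomial of least size vanishing at z is irreducible; the quotient by it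
    embeds into [R[i]] by sending the class of X to z. *)
Lemma number_field_of_root (z : R[i]) (q : {poly rat}) :
  q != 0 -> root (map_poly ratr q) z ->
  exists (L : fieldExtType rat) (iota : {rmorphism L -> R[i]}) (w : L),
    <<1; w>>%VS = fullv /\ iota w = z.
Proof.
move=> q0 qz.
pose P k := boolp.asbool
  (exists2 p : {poly rat}, p != 0 /\ root (map_poly ratr p) z & size p = k).
have exP : exists k, P k by exists (size q); apply/boolp.asboolP; exists q.
have [k /boolp.asboolP[p [p0 pz] <-] kmin] := ex_minnP exP.
have irr_p : irreducible_poly p.
  apply/(subfx_irreducibleP pz p0) => r rz r0.
  by apply: kmin; apply/boolp.asboolP; exists r.
pose L := SubFieldExtType pz irr_p.
exists L, (@subfx_inj _ _ (@ratr R[i]) z p), (subfx_root _ z p).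
split; last exact: subfx_inj_root.
apply/vspaceP => x; rewrite memvf; apply/Fadjoin_polyP.
have [r ->] := subfxEroot pz p0 x.
exists (map_poly (in_alg L) r) => //.
by apply/polyOverP => i; rewrite coef_map memvZ ?mem1v.
Qed.

(** If w has exact order m, then X^m - 1 splits into the factors X - w^i, and w is one of its roots,
    so these roots generate L. *)
Lemma splitting_of_unity_root (L : fieldExtType rat) (w : L) n : (0 < n)%N ->
  w ^+ n = 1 -> <<1; w>>%VS = fullv -> SplittingField.axiom L.
Proof.
move=> n0 wn gen; have [m prim_w _] := prim_order_exists n0 wn.
exists ('X^m - 1); first by rewrite rpredB ?rpredX ?polyOverX ?rpred1.
exists [seq w ^+ i | i <- index_iota 0 m].
  by rewrite big_map (factor_Xn_sub_1 prim_w) eqpxx.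
apply: subv_anti; rewrite subvf -gen; apply/FadjoinP; split.
  exact: subv_adjoin_seq.
apply: seqv_sub_adjoin; apply/mapP.
have m0 := prim_order_gt0 prim_w.
(* The reduction modulo m covers m = 1, where 0 is the only exponent listed. *)
exists (1 %% m)%N; last by rewrite (prim_expr_mod prim_w).
by rewrite mem_index_iota ltn_pmod.
Qed.

(** Automorphisms fix the rationals; what remains is to exhibit Q(omega_n) as a splitting field
    inside [R[i]]. *)
Lemma rational_fixed n (r : rat) : (0 < n)%N ->
  fixed_by_cyclotomic_galois n (ratr r : R)%:C.
Proof.
move=> n0; pose q : {poly rat} := 'X^n - 1.
have [] := @number_field_of_root (omega R n) q.
- by rewrite -size_poly_eq0 size_XnsubC.
- rewrite /root rmorphB /= map_polyXn rmorph1 hornerD hornerN hornerXn hornerC.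
  by rewrite omega_unity // subrr.
move=> L0 [iota [w [gen wE]]].
have wn : w ^+ n = 1.
  by apply: (fmorph_inj iota); rewrite rmorphXn /= wE omega_unity // rmorph1.
have iota_r : iota (ratr r) = (ratr r)%:C by rewrite !fmorph_rat.
pose LM := FieldExt_isSplittingField.Build rat L0
  (splitting_of_unity_root n0 wn gen).
pose L : splittingFieldType rat := HB.pack L0 LM.
exists L, iota, w, (ratr r); split=> //.
by apply/fixedFieldP => [|s _]; rewrite ?memvf // fmorph_rat.
Qed.

End CyclotomicField.

(** * Parity is not eventually a rational function *)

Lemma ratfun_value_odd (f : {fraction {poly rat}}) N :
  ~ (forall n, (N <= n)%N -> ratfun_value f n%:R (odd n)%:R).
Proof.
move=> fP.
have [a [d [fE d0]]] : exists a d : {poly rat},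
    f = tofrac a / tofrac d /\ d != 0.
  have [a [d [fE dN _]]] := fP N (leqnn N); exists a, d; split=> //.
  by apply: contraNneq dN => ->; rewrite horner0.
(* The fraction representing [f] may change with the point; cross-multiplication compares each with
   the fixed one a / d. *)
have cross p q : q != 0 -> f = tofrac p / tofrac q -> p * d = a * q.
  move=> q0; rewrite fE => /eqP; rewrite eqr_div ?tofrac_eq0 //.
  by rewrite -!tofracM tofrac_eq => /eqP ->.
have evenroot n : (N <= n)%N -> ~~ odd n -> root a n%:R.
  move=> Nn on; have [p [q [fpq qn]]] := fP n Nn.
  rewrite (negPf on) => /esym/eqP; rewrite mulf_eq0 invr_eq0 (negPf qn) orbF.
  move=> /eqP pn.
  have q0 : q != 0 by apply: contraNneq qn => ->; rewrite horner0.
  have /(congr1 (horner^~ n%:R)) := cross _ _ q0 fpq.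
  rewrite !hornerM pn mul0r => /esym/eqP; rewrite mulf_eq0 (negPf qn) orbF.
  exact.
have a0 : a = 0.
  apply/eqP; apply: contraT => a0.
  (* These are [size a] distinct even integers from N on, more roots than a nonzero [a] can have. *)
  pose rs : seq rat := [seq (N.*2 + i.*2)%:R | i <- iota 0 (size a)].
  have := max_poly_roots (rs := rs) a0; rewrite size_map size_iota ltnn.
  move=> H; apply: H.
    apply/allP => _ /mapP[i _ ->]; apply: evenroot.
      by rewrite -addnn -addnA leq_addr.
    by rewrite oddD !odd_double.
  rewrite map_inj_uniq ?iota_uniq // => i j /eqP.
  by rewrite eqr_nat eqn_add2l => /eqP/double_inj.
(* At the odd point 2N + 1 the value should be 1, but a = 0 forces the numerator to vanish. *)
have NN : (N <= N.*2.+1)%N by rewrite -addnn leqW // leq_addr.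
have [p [q [fpq qn]]] := fP _ NN.
have q0 : q != 0 by apply: contraNneq qn => ->; rewrite horner0.
have := cross _ _ q0 fpq; rewrite a0 mul0r => /eqP.
rewrite mulf_eq0 (negPf d0) orbF => /eqP ->.
by rewrite /= odd_double horner0 mul0r => /eqP; rewrite oner_eq0.
Qed.

Theorem theorem2p6 (R : realType) :
  (forall b : nat -> rat,
     exists F : poly_family,
       [/\ compatible F,
           total_degree_le F 2
         & forall n : nat, (2 <= n)%N -> cosine_eval R F n = ratr (b n)])
  /\
  (exists F : poly_family,
     [/\ compatible F,
         exists d : nat, total_degree_le F d,
         forall n : nat, (2 <= n)%N -> value_level_invariant R F n
       & ~ summable_at_cosine_points R F]).
Proof.
split; first exact: interpolation.
have [F [compF degF evalF]] := interpolation R (fun n => (odd n)%:R).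
exists F; split=> //; first by exists 2%N.
  move=> n n2; rewrite /value_level_invariant evalF //.
  by apply: rational_fixed; apply: ltnW.
move=> [N [f [N2 fP]]]; apply: (@ratfun_value_odd f N) => n Nn.
have [v fv] := fP n Nn; rewrite evalF ?(leq_trans N2) // => /fmorph_inj vE.
by rewrite vE.
Qed.
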